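(* Let $f\colon\mathcal{E}\to\overline{\mathbb{R}}_{++}$ be any upper semicontinuous, strictly upper radial function such that every $y\in\mathcal{E}$ has $\lim_{v\to 0} v\cdot f(y/v)=0$. Then $f^\Gamma$ is $1/R(f)$-Lipschitz continuous.
   Context: $\mathcal{E}$ is a finite-dimensional Euclidean space with norm $\|\cdot\|$, and $\overline{\mathbb{R}}_{++}=\mathbb{R}_{++}\cup\{0,+\infty\}$. For $f\colon\mathcal{E}\to\overline{\mathbb{R}}_{++}$: $\mathrm{epi}\,f=\{(x,u)\in\mathcal{E}\times\mathbb{R}_{++}: f(x)\le u\}$ and $\mathrm{hypo}\,f=\{(x,u)\in\mathcal{E}\times\mathbb{R}_{++}: f(x)\ge u\}$; $f$ is upper semicontinuous if $\mathrm{hypo}\,f$ is closed with respect to $\mathcal{E}\times\mathbb{R}_{++}$. A function $g$ is (uniformly) $M$-Lipschitz continuous if $|g(x)-g(x')|\le M\|x-x'\|$ for all $x,x'\in\mathcal{E}$. The function $f$ is upper radial if the perspective function $f^p(y,v)=v\cdot f(y/v)$ is upper semicontinuous and nondecreasing in $v\in\mathbb{R}_{++}$; it is strictly upper radial if moreover $f^p(y,v)$ is strictly increasing in $v$ whenever $f^p(y,v)\in\mathbb{R}_{++}$. With $\Gamma(x,u)=(x,1)/u$, the radial dual is $f^\Gamma(y)=\sup\{v>0: (y,v)\in\Gamma(\mathrm{epi}\,f)\}=\sup\{v>0: v\cdot f(y/v)\le 1\}$, with $\sup\emptyset=0$. Proximal normals of $S\subseteq\mathcal{E}\times\mathbb{R}$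 at $(x,u)\in S$: $N^P_S((x,u))=\{(\zeta,\delta): (x,u)\text{ is a nearest point of }S\text{ to }(x,u)+\epsilon(\zeta,\delta)\text{ for some }\epsilon>0\}$. $R(f)=\inf\{\|x'\| : (x,u)\in\mathrm{hypo}\,f,\ 0\ne(\zeta,\delta)\in N^P_{\mathrm{hypo}\,f}((x,u)),\ x'\in\mathcal{E},\ (\zeta,\delta)^T((x',0)-(x,u))=0\}$. *)

(* Defs.v *)
From HB Require Import structures.
From mathcomp Require Import all_boot all_order all_algebra.
From mathcomp Require Import all_classical all_reals all_analysis.
Set Implicit Arguments.
Unset Strict Implicit.
Unset Printing Implicit Defensive.
Import Order.TTheory GRing.Theory Num.Theory.
Import numFieldNormedType.Exports.
Local Open Scope classical_set_scope.
Local Open Scope ring_scope.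

Definition pos_reals (R : realType) : set R := [set u | 0 < u].

Section Semicontinuity.
Context {R : realType} {T : topologicalType}.

Definition epi (D : set T) (g : T -> \bar R) : set (T * R) :=
  [set p | (D `*` @pos_reals R) p /\ (g p.1 <= p.2%:E)%E].

Definition hypo (D : set T) (g : T -> \bar R) : set (T * R) :=
  [set p | (D `*` @pos_reals R) p /\ (p.2%:E <= g p.1)%E].

(* The subspace topology makes this closedness relative to D x R_{++},
   not closedness in T x R. *)
Definition upper_semicontinuous_on (D : set T) (g : T -> \bar R) : Prop :=
  closed (hypo D g : set (subspace (D `*` @pos_reals R))).

End Semicontinuity.

(* A norm and topology are given; the inner product has to induce that norm. *)
Definition finite_dim_euclidean (R : realType) (E : normedModType R)
    (dot : {dot E for idfun}) : Prop :=
  (exists n : nat, inhabited (Vector.axiom n E)) /\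
  (forall x : E, dot x x = `|x| ^+ 2).

Section Radial.
Context {R : realType} {E : normedModType R}.

Definition perspective (f : E -> \bar R) (p : E * R) : \bar R :=
  (p.2%:E * f (p.2^-1 *: p.1))%E.

Definition upper_radial (f : E -> \bar R) : Prop :=
  upper_semicontinuous_on (setT `*` @pos_reals R) (perspective f) /\
  (forall (y : E) (v w : R), 0 < v -> v <= w ->
     (perspective f (y, v) <= perspective f (y, w))%E).

Definition strictly_upper_radial (f : E -> \bar R) : Prop :=
  upper_radial f /\
  (forall (y : E) (v w : R), 0 < v -> v < w ->
     (0 < perspective f (y, v) < +oo)%E ->
     (0 < perspective f (y, w) < +oo)%E ->
     (perspective f (y, v) < perspective f (y, w))%E).

Definition Gamma (p : E * R) : E * R := (p.2^-1 *: p.1, p.2^-1).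

(* The maximum with 0 only matters for sup of the empty set, which is -oo for
   ereal_sup and 0 by convention here. *)
Definition radial_dual (f : E -> \bar R) (y : E) : \bar R :=
  maxe 0%E (ereal_sup
    [set v%:E | v in [set v : R | 0 < v /\ (Gamma @` epi setT f) (y, v)]]).

(* The library's norm on E * R is the max norm, and nearest points are meant
   with respect to the Euclidean one. *)
Definition prod_enorm (p : E * R) : R := Num.sqrt (`|p.1| ^+ 2 + p.2 ^+ 2).

Definition prod_dot (dot : {dot E for idfun}) (p q : E * R) : R :=
  dot p.1 q.1 + p.2 * q.2.

Definition proximal_normal (S : set (E * R)) (p : E * R) : set (E * R) :=
  [set n | S p /\ exists2 eps : R, 0 < eps &
     forall q, S q ->
       prod_enorm ((p.1 + eps *: n.1, p.2 + eps * n.2) - p) <=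
       prod_enorm ((p.1 + eps *: n.1, p.2 + eps * n.2) - q)].

Definition intercept_radius (dot : {dot E for idfun}) (f : E -> \bar R) : \bar R :=
  ereal_inf [set `|x'|%:E | x' in [set x' : E |
    exists p n : E * R, [/\ hypo setT f p, n <> 0,
      proximal_normal (hypo setT f) p n &
      prod_dot dot n ((x', 0) - p) = 0]]].

(* The difference of two equal infinite values counts as 0, whereas
   +oo - +oo = -oo in the library. *)
Definition edist (a b : \bar R) : \bar R :=
  if a == b then 0%E else `|a - b|%E.

(* M may be +oo, in which case the bound is vacuous (+oo * 0 = 0 and
   edist a a = 0). *)
Definition elipschitz (M : \bar R) (g : E -> \bar R) : Prop :=
  forall x x' : E, (edist (g x) (g x') <= M * `|x - x'|%:E)%E.

End Radial.

(* Main.v *)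
Require Import Defs.
From HB Require Import structures.
From mathcomp Require Import all_boot all_order all_algebra.
From mathcomp Require Import all_classical all_reals all_analysis.
From mathcomp Require Import ring lra.
Import Order.TTheory GRing.Theory Num.Theory.
Import numFieldNormedType.Exports.
Local Open Scope classical_set_scope.
Local Open Scope ring_scope.

(* Write g for the radial dual of f. Gamma maps hypo f onto
   A = {(y, v) | v > 0, v f(y/v) >= 1}, which is the epigraph of g and is closed
   in E x R. If g x' > g x + K |x - x'| with K > 0, let (y, w) minimise
   v + K |x' - y| over A, with minimum c; then y <> x'. Through Gamma, minimality
   says that hypo f lies in {(q, u) | c u - K |q - u x'| <= 1}, with equality at
   (y/w, 1/w). The boundary of that set is smooth there, because y <> x', and its
   normal (-K e, c + K <e, x'>), |e| = 1, is a proximal normal of hypo f whose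
   hyperplane meets u = 0 at - e / K. Hence R(f) <= 1 / K. *)

(** * Compactness of balls in finite dimension *)

(** In coordinates the ball is closed and bounded, and its image under the continuous map [r2v] is
    the ball itself. *)
Lemma finite_dim_closed_ball_compact (R : realType) (E : normedModType R)
    (n : nat) (axE : Vector.axiom n E) (x : E) (r : R) :
  compact [set y : E | `|x - y| <= r].
Proof.
case: axE => v2r lin_v2r bij_v2r.
pose lv : {linear E -> 'rV[R]_n} := HB.pack v2r
  (GRing.isLinear.Build _ _ _ _ v2r lin_v2r).
have [w2e v2rK w2eK] := bij_v2r.
(* The inverse of [v2r], written as a finite combination so that its continuity is visible. *)
pose r2v (w : 'rV[R]_n) : E := \sum_(i < n) w 0 i *: w2e (delta_mx 0 i).
have r2vK y : r2v (v2r y) = y.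
  apply: (bij_inj bij_v2r); rewrite -[v2r (r2v _)]/(lv _) /r2v linear_sum /=.
  rewrite [RHS]row_sum_delta; apply: eq_bigr => i _.
  by rewrite -[v2r _]/(lv _) linearZ /= w2eK.
have r2v_inj w : r2v w = 0 -> w = 0.
  move=> w0; have : v2r (r2v w) = w.
    rewrite -[v2r _]/(lv _) /r2v linear_sum /= [RHS]row_sum_delta.
    by apply: eq_bigr => i _; rewrite -[v2r _]/(lv _) linearZ /= w2eK.
  by rewrite w0 => <-; rewrite -[v2r _]/(lv _) linear0.
have r2vZ a w : r2v (a *: w) = a *: r2v w.
  by rewrite /r2v scaler_sumr; apply: eq_bigr => i _; rewrite mxE scalerA.
have r2v_cont : continuous r2v.
  apply: continuous_big => [|i _ w]; first exact: add_continuous.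
  by apply: cvgZr_tmp (@coord_continuous R 1 n 0 i w).
have norm_cont : continuous (fun w => `|r2v w|).
  by move=> w; apply: cvg_norm (r2v_cont w).
(* By injectivity, [|r2v w|] has a positive minimum on the compact unit sphere; [K] is its inverse.
   The sphere is empty when all [w] vanish. *)
have [K K0 r2vK_le] : exists2 K : R, 0 < K & forall w, `|w| <= K * `|r2v w|.
  pose S := [set w : 'rV[R]_n | `|w| = 1].
  have [S0|S0] := pselect (S !=set0); last first.
    exists 1 => // w; have [->|w0] := eqVneq w 0; first by rewrite normr0 mulr_ge0.
    by exfalso; apply: S0; exists (`|w|^-1 *: w); rewrite /S /= normrZV ?unitfE ?normr_eq0.
  have cS : compact S.
    apply: bounded_closed_compact.
      by exists 1; split => [|y /ltW y1 w /= ->]; first exact: num_real.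
    rewrite (_ : S = (fun w : 'rV[R]_n => `|w|) @^-1` [set 1]) //.
    move/continuous_closedP: (@norm_continuous _ 'rV[R]_n); apply.
    exact: closed_eq.
  have [w0 /set_mem w0S min_w0] := EVT_min_rV S0 cS (continuous_subspaceT norm_cont).
  have w0_gt0 : 0 < `|r2v w0|.
    rewrite normr_gt0; apply/eqP => /r2v_inj w00.
    by move: w0S; rewrite /S /= w00 normr0 => /esym/eqP; rewrite oner_eq0.
  exists `|r2v w0|^-1; first by rewrite invr_gt0.
  move=> w; have [->|wn0] := eqVneq w 0; first by rewrite normr0 mulr_ge0// invr_ge0.
  rewrite ler_pdivlMl //.
  have := min_w0 (`|w|^-1 *: w); rewrite inE /S /= normrZV ?unitfE ?normr_eq0 // => /(_ erefl).
  by rewrite r2vZ normrZ normfV normr_id ler_pdivlMl ?normr_gt0 // mulrC.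
have -> : [set y : E | `|x - y| <= r] = r2v @` [set w | `|x - r2v w| <= r].
  by apply/seteqP; split => [y xy|_ [w ? <-]//]; exists (v2r y); rewrite /= r2vK.
apply: continuous_compact; first exact: continuous_subspaceT.
apply: bounded_closed_compact.
  exists (K * (`|x| + r)); split; first exact: num_real.
  move=> y ly w /= xw; apply: le_trans (r2vK_le w) _; apply: le_trans (ltW ly).
  rewrite ler_pM2l //; apply: le_trans (_ : `|x| + `|x - r2v w| <= _).
    by rewrite -[X in `|X|](subKr x) (le_trans (ler_normB _ _)).
  by rewrite lerD2l.
have xr2v_cont : continuous (fun w => `|x - r2v w|).
  by move=> w; apply: cvg_norm (cvgB (cvg_cst x) (r2v_cont w)).
by move/continuous_closedP: xr2v_cont => /(_ _ (@closed_le R r)).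
Qed.

(** * Proximal normals from quadratic bounds *)

Section EuclideanNorm.
Context {R : realType} {E : normedModType R} {dot : {dot E for idfun}}.
Context (dotE : forall x : E, dot x x = `|x| ^+ 2).

Lemma dotC x y : dot x y = dot y x.
Proof. by rewrite (hermC dot x y) expr0 mul1r. Qed.

Lemma dotZl (a : R) x y : dot (a *: x) y = a * dot x y.
Proof. exact: linearZl_LR. Qed.

Lemma dotZr (a : R) x y : dot x (a *: y) = a * dot x y.
Proof. by rewrite dotC dotZl dotC. Qed.

Lemma dotBr x y z : dot x (y - z) = dot x y - dot x z.
Proof. exact: linearBr. Qed.

Lemma sqr_normD x y : `|x + y| ^+ 2 = `|x| ^+ 2 + 2 * dot x y + `|y| ^+ 2.
Proof. by rewrite -!dotE linearDl !linearDr /= (dotC y x); ring. Qed.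

Lemma sqr_normB x y : `|x - y| ^+ 2 = `|x| ^+ 2 - 2 * dot x y + `|y| ^+ 2.
Proof. by rewrite -!dotE linearBl !linearBr /= (dotC y x); ring. Qed.

(* AM-GM: 2 |a| |a + h| <= |a| ^+ 2 + |a + h| ^+ 2. *)
Lemma normD_tangent_le (a h : E) :
  2 * `|a| * (`|a + h| - `|a|) <= 2 * dot a h + `|h| ^+ 2.
Proof.
by have := sqr_normD a h; have := sqr_ge0 (`|a + h| - `|a|); rewrite sqrrB; lra.
Qed.

(** With step 1 / (2 B), expanding the squared distances turns the nearest-point inequality into the
    assumed bound. *)
Lemma proximal_normal_inner (S : set (E * R)) (p n : E * R) (B : R) :
  0 < B -> S p ->
  (forall q, S q -> dot n.1 (q.1 - p.1) + n.2 * (q.2 - p.2) <=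
     B * (`|q.1 - p.1| ^+ 2 + (q.2 - p.2) ^+ 2)) ->
  proximal_normal S p n.
Proof.
case: p n => [x u] [n1 n2] /= B0 Sp inner; split => //=.
exists (2 * B)^-1; first by rewrite invr_gt0 mulr_gt0.
move=> [y w] Sq; rewrite /prod_enorm /=; set eps := _^-1.
have eps0 : 0 < eps by rewrite invr_gt0 mulr_gt0.
apply: ler_wsqrtr.
rewrite (addrC x) addrK -[eps *: n1 + x - y]addrA -[x - y]opprB.
rewrite sqr_normB dotZl (addrC u) addrK -[eps * n2 + u - w]addrA -[u - w]opprB.
have := inner _ Sq; rewrite -(ler_pM2l (_ : 0 < 2 * eps)) ?mulr_gt0 //=.
rewrite [leRHS]mulrA (_ : 2 * eps * B = 1); first lra.
by rewrite /eps; field; rewrite gt_eqF.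
Qed.

(** F(q, u) = c u - K |q - u z| attains its maximum over [S] at [p] and is smooth there, so its
    gradient is normal to [S]; the tangent bound on the norm makes this normal proximal. *)
Lemma proximal_normal_of_cone_bound (S : set (E * R)) (p : E * R) (z : E)
    (c K : R) :
  0 < K -> S p ->
  (forall q, S q -> c * q.2 - K * `|q.1 - q.2 *: z| <= 1) ->
  c * p.2 - K * `|p.1 - p.2 *: z| = 1 -> p.1 != p.2 *: z ->
  exists n x', [/\ n <> 0, proximal_normal S p n,
    prod_dot dot n ((x', 0) - p) = 0 & `|x'| = K^-1].
Proof.
case: p => x u /= K0 Sp bound boundp xuz.
pose a := x - u *: z; pose N := `|a|.
have a0 : a != 0 by rewrite subr_eq0.
have N0 : 0 < N by rewrite normr_gt0.
have aE : dot a a = N ^+ 2 by [].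
(* The gradient of F at [p], and the multiple of [a] whose product with the first component of that
   gradient is 1. *)
exists (- (K / N) *: a, c + K / N * dot a z), (- (K * N)^-1 *: a); split.
- case=> /eqP; rewrite scaler_eq0 (negPf a0) orbF oppr_eq0.
  by rewrite gt_eqF // divr_gt0.
- apply: (@proximal_normal_inner _ _ _ (K / N * (1 + `|z| ^+ 2))) => //.
    by rewrite mulr_gt0 ?divr_gt0 // ltr_pwDl // sqr_ge0.
  move=> [y w] Sq /=; have /= := bound _ Sq.
  have -> : y - w *: z = a + (y - x - (w - u) *: z).
    by rewrite scalerBl /a addrACA (addrC x) subrK -opprD (addrC (u *: z)) subrK.
  rewrite -[X in c * X](subrK u); move: (y - x) (w - u) boundp => k l boundp boundq.
  rewrite -/a -/N in boundp.
  have tangent := normD_tangent_le a (k - l *: z).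
  (* Parallelogram law: add the square of [|k + l *: z|]. *)
  have hz : `|k - l *: z| ^+ 2 <= 2 * (1 + `|z| ^+ 2) * (`|k| ^+ 2 + l ^+ 2).
    have := sqr_ge0 `|k + l *: z|; rewrite sqr_normB sqr_normD dotZr normrZ.
    rewrite exprMn real_normK ?num_real //.
    have := mulr_ge0 (sqr_ge0 `|z|) (sqr_ge0 `|k|); have := sqr_ge0 l; have := sqr_ge0 `|k|.
    lra.
  rewrite dotZl /= -(ler_pM2l (_ : 0 < 2 * N)) ?mulr_gt0 //.
  move: tangent; rewrite -/N dotBr dotZr => tangent.
  have -> : 2 * N * (- (K / N) * dot a k + (c + K / N * dot a z) * l) =
      2 * N * c * l - K * (2 * (dot a k - l * dot a z)).
    by field; rewrite gt_eqF.
  have -> : 2 * N * (K / N * (1 + `|z| ^+ 2) * (`|k| ^+ 2 + l ^+ 2)) =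
      K * (2 * (1 + `|z| ^+ 2) * (`|k| ^+ 2 + l ^+ 2)).
    by field; rewrite gt_eqF.
  apply: le_trans (ler_wpM2l (ltW K0) hz).
  have := ler_wpM2l (ltW K0) tangent.
  (* The bound at q minus the equality at [p], scaled by [N]. *)
  have : 0 <= N * (K * (`|a + (k - l *: z)| - N) - c * l).
    by rewrite mulr_ge0 ?(ltW N0) //; move: boundp boundq; lra.
  lra.
(* F is positively homogeneous, so its gradient paired with [p] gives F(p) = 1, the same value as at
   (x', 0). *)
- rewrite /prod_dot /= dotBr !dotZl !dotZr aE.
  have axz : dot a x = N ^+ 2 + u * dot a z.
    by rewrite -aE -dotZr -linearDr /= subrK.
  rewrite axz sub0r -[X in _ = X](subrr (1 : R)) -{2}boundp -/a -/N.
  by field; rewrite !gt_eqF.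
- rewrite normrZ normrN normfV ger0_norm ?mulr_ge0 ?ltW // -/N.
  by rewrite invfM -mulrA mulVf ?mulr1 // gt_eqF.
Qed.
End EuclideanNorm.

(** * The radial dual and the image of the hypograph *)

Section DualEpigraph.
Context {R : realType} {E : normedModType R}.
Implicit Types (f : E -> \bar R) (x y : E) (u v : R).

(** The image of [hypo setT f] under [Gamma], since v f(y/v) >= 1 means f(y/v) >= 1/v. *)
Definition dual_epi f : set (E * R) :=
  [set p | 0 < p.2 /\ (1 <= perspective f p)%E].

(** [Gamma] is an involution on positive heights. *)
Lemma Gamma_epiE f y v : 0 < v ->
  (Gamma @` epi setT f) (y, v) <-> (perspective f (y, v) <= 1)%E.
Proof.
move=> v0; rewrite /perspective /=.
have -> : (v%:E * f (v^-1 *: y) <= 1)%E = (f (v^-1 *: y) <= (v^-1)%:E)%E.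
  by rewrite muleC -lee_pdivlMr // mul1e.
split=> [[[x u] [[_ /= u0] fxu] [xy uv]]|fyv].
  by rewrite -uv -xy invrK scalerA divff ?scale1r // gt_eqF.
exists (v^-1 *: y, v^-1); last first.
  by rewrite /Gamma /= invrK scalerA divff ?scale1r // gt_eqF.
by split => //; split => //=; rewrite /pos_reals /= invr_gt0.
Qed.

Lemma hypo_dual_epi f x u : hypo setT f (x, u) <-> dual_epi f (u^-1 *: x, u^-1).
Proof.
rewrite /dual_epi /perspective /= invr_gt0; split=> [[[_ u0] fxu]|[u0]].
  split => //; rewrite invrK scalerA divff ?gt_eqF // scale1r.
  by rewrite lee_pdivlMl // mule1.
rewrite invrK scalerA divff ?gt_eqF // scale1r lee_pdivlMl // mule1.
by move=> fxu; split.
Qed.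

Lemma radial_dual_ge0 f y : (0 <= radial_dual f y)%E.
Proof. by rewrite le_max lexx. Qed.

Lemma radial_dual_lt f y v : (radial_dual f y < v%:E)%E -> dual_epi f (y, v).
Proof.
move=> fyv; have v0 : 0 < v by rewrite -lte_fin (le_lt_trans _ fyv) ?radial_dual_ge0.
split => //; rewrite leNgt; apply/negP => /ltW /(Gamma_epiE _ _ _ v0) Gyv.
move: fyv; rewrite ltNge => /negP; apply.
by rewrite le_max ereal_sup_ubound ?orbT //; exists v.
Qed.

(** If w > v had f^p(y, w) <= 1, monotonicity would force the value 1 at both v and w, against
    strictness. *)
Lemma radial_dual_le f y v :
  strictly_upper_radial f -> dual_epi f (y, v) -> (radial_dual f y <= v%:E)%E.
Proof.
move=> [[_ mono] strict] [/= v0 f1]; rewrite ge_max lee_fin ltW //=.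
apply: ge_ereal_sup => _ [w [w0 /(Gamma_epiE _ _ _ w0) fw1] <-].
rewrite lee_fin leNgt; apply/negP => vw.
have fvw := mono y v w v0 (ltW vw).
have fv1 : perspective f (y, v) = 1%E.
  by apply/eqP; rewrite eq_le f1 (le_trans fvw).
have fw : perspective f (y, w) = 1%E.
  by apply/eqP; rewrite eq_le fw1 (le_trans f1).
have := strict y v w v0 vw; rewrite fv1 fw lte01 ltey /= => /(_ isT isT).
by rewrite ltxx.
Qed.

(* Upper semicontinuity is relative to v > 0; the points (y, v) with
   f^p(y, v) < 1 and monotonicity keep dual_epi f locally away from v = 0. *)
Lemma dual_epi_closed f :
  upper_radial f ->
  (forall y, exists2 v, 0 < v & (perspective f (y, v) < 1)%E) ->
  closed (dual_epi f).
Proof.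
move=> [/closed_subspaceP[C clC CE] mono] small.
(* [dual_epi f] is the slice at height 1 of the hypograph of the perspective function. *)
have dualE p : 0 < p.2 -> dual_epi f p <-> C (p, 1).
  move=> p0; have := CE; rewrite predeqE => /(_ (p, 1)) CEp.
  have D1 : ((([set: E] `*` @pos_reals R) `*` @pos_reals R) (p, 1)) by split => //=; exact: ltr01.
  split=> [[_ f1]|Cp]; first by have [_ /(_ (conj (conj D1 f1) D1)) []] := CEp.
  by have [/(_ (conj Cp D1)) [[_ f1] _] _] := CEp.
move=> [y v] clyv.
have [v0 v0_gt0 fv0] := small y.
have Ny : \forall y' \near y, ~ C ((y', v0), 1).
  have oC : open (~` C) by rewrite openC.
  have cont : continuous (fun y' : E => ((y', v0), 1 : R)).
    by move=> y'; exact: (cvg_pair (cvg_pair cvg_id (cvg_cst _)) (cvg_cst _)).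
  suff : nbhs ((y, v0), 1 : R) (~` C) by move/cont.
  apply: open_nbhs_nbhs; split => // Cy.
  by have [_ /=] := (dualE (y, v0) v0_gt0).2 Cy; rewrite leNgt fv0.
(* Otherwise points of [dual_epi f] near (y, v) have height below [v0], and monotonicity gives
   f^p(y', v0) >= 1 for y' near y, against [Ny]. *)
have vv0 : v0 <= v.
  rewrite leNgt; apply/negP => vv0.
  have : nbhs (y, v) [set p : E * R | ~ C ((p.1, v0), 1) /\ p.2 < v0].
    have N1 : nbhs (y, v) [set p : E * R | ~ C ((p.1, v0), 1)].
      exact: (@cvg_fst _ _ _ (nbhs v) _ _ Ny).
    have N2 : nbhs (y, v) [set p : E * R | p.2 < v0].
      exact: (@cvg_snd _ _ (nbhs y) _ _ _ (lt_nbhsl vv0)).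
    exact: filterI N1 N2.
  move=> /clyv[[y' v'] [[/= v'0 f1] [/= nC v'v0]]]; apply: nC.
  apply/dualE => //; split => //; exact: le_trans f1 (mono _ _ _ v'0 (ltW v'v0)).
apply/dualE; first exact: (lt_le_trans v0_gt0 vv0).
have clC1 : closed ((fun p : E * R => (p, 1 : R)) @^-1` C).
  have cont1 : continuous (fun p : E * R => (p, 1 : R)).
    by move=> p; exact: (cvg_pair cvg_id (cvg_cst _)).
  by move/continuous_closedP: cont1; apply.
apply: (clC1 (y, v)) => B /clyv [p [Ap Bp]].
by exists p; split => //; apply/dualE => //; case: Ap.
Qed.
End DualEpigraph.

(** * Minimisation and the growth bound *)

(** Heights are nonnegative and K > 0, so the sublevel set through any point of [A] lies in a ball
    times a segment, which is compact. *)
Lemma exists_min_add_dist (R : realType) (E : normedModType R) (n : nat)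
    (axE : Vector.axiom n E) (A : set (E * R)) (z : E) (K : R) :
  0 < K -> closed A -> A !=set0 -> (forall p, A p -> 0 <= p.2) ->
  exists2 p, A p & forall q, A q -> p.2 + K * `|z - p.1| <= q.2 + K * `|z - q.1|.
Proof.
move=> K0 clA [p0 Ap0] A_ge0.
pose g (p : E * R) := p.2 + K * `|z - p.1|.
pose B := [set y : E | `|z - y| <= g p0 / K] `*` `[0, g p0]%classic.
have cA : compact (A `&` B).
  rewrite setIC; apply: compact_closedI => //.
  apply: compact_setX; last exact: segment_compact.
  exact: finite_dim_closed_ball_compact axE _ _.
have AB q : A q -> g q <= g p0 -> B q.
  move=> Aq gq; have := A_ge0 _ Aq; have : 0 <= K * `|z - q.1|.
    by rewrite mulr_ge0 // ltW.
  move: gq; rewrite /B /= in_itv /= ler_pdivlMr // mulrC /g => gq z0 q0.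
  by split; [|apply/andP; split]; lra.
have cg : continuous g.
  move=> p; apply: cvgD; first exact: cvg_snd.
  apply: cvgM; first exact: cvg_cst.
  by apply: cvg_norm; apply: cvgB; [exact: cvg_cst|exact: cvg_fst].
have AB0 : (A `&` B) !=set0 by exists p0; split => //; apply: AB.
have [p /set_mem [Ap _] minp] := compact_EVT_min AB0 cA (continuous_subspaceT cg).
exists p => // q Aq; have [gq|gq] := leP (g q) (g p0).
  by apply: minp; rewrite inE; split => //; apply: AB.
by apply: le_trans (ltW gq); apply: minp; rewrite inE; split => //; apply: AB.
Qed.

Lemma radial_dual_growth (R : realType) (E : normedModType R)
    (dot : {dot E for idfun}) (f : E -> \bar R) (K : R) (x x' : E) :
  finite_dim_euclidean dot -> strictly_upper_radial f ->
  (forall y, exists2 v, 0 < v & (perspective f (y, v) < 1)%E) ->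
  0 < K -> (K^-1%:E < intercept_radius dot f)%E ->
  (radial_dual f x' <= radial_dual f x + (K * `|x - x'|)%:E)%E.
Proof.
move=> [[n [axE]] dotE] rad small K0 KR; rewrite leNgt; apply/negP => gx.
have gx_fin : radial_dual f x \is a fin_num.
  rewrite fin_numElt (lt_le_trans _ (radial_dual_ge0 _ _)) //=.
  by rewrite ltNge; apply: contraTN gx => /=; rewrite leye_eq => /eqP ->; rewrite -leNgt leey.
(* A real [M] is needed because the dual at [x'] may be infinite. *)
have [M gxM Mgx'] : exists2 M : R, fine (radial_dual f x) + K * `|x - x'| < M &
    (M%:E <= radial_dual f x')%E.
  move: gx; rewrite -(fineK gx_fin) -EFinD /=.
  case: (radial_dual f x') => [s| |] //= rs; first by exists s.
  by exists (fine (radial_dual f x) + K * `|x - x'| + 1); rewrite ?leey // ltrDl.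
have [v Axv vM] : exists2 v, dual_epi f (x, v) & v + K * `|x' - x| < M.
  exists (fine (radial_dual f x) + (M - (fine (radial_dual f x) + K * `|x - x'|)) / 2).
    by apply: radial_dual_lt; rewrite -{1}(fineK gx_fin) lte_fin; lra.
  by rewrite (distrC x'); lra.
have clA := dual_epi_closed f rad.1 small.
have A0 : dual_epi f !=set0 by exists (x, v).
have A_ge0 p : dual_epi f p -> 0 <= p.2 by case=> /ltW.
have [[y w] Ayw minyw] := exists_min_add_dist _ _ _ axE _ x' K K0 clA A0 A_ge0.
have w0 : 0 < w by case: Ayw.
pose c := w + K * `|x' - y|.
(* If y = x', then g x' <= w <= v + K |x' - x| < M <= g x', where g is the radial dual. *)
have yx' : y != x'.
  apply/eqP => yx'; have := radial_dual_le _ _ _ rad Ayw.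
  rewrite yx' leNgt => /negP; apply; apply: lt_le_trans Mgx'.
  have := minyw _ Axv; rewrite /= yx' subrr normr0 mulr0 addr0 lte_fin => wv.
  exact: le_lt_trans wv vM.
have p_hypo : hypo setT f (w^-1 *: y, w^-1).
  apply/hypo_dual_epi; rewrite invrK scalerA divff ?gt_eqF //.
  by rewrite scale1r.
have distE (q1 : E) (u : R) : 0 < u -> `|q1 - u *: x'| = u * `|x' - u^-1 *: q1|.
  move=> u0; rewrite -[X in X * _](gtr0_norm u0) -normrZ scalerBr scalerA.
  by rewrite divff ?gt_eqF // scale1r distrC.
have [|||n0 [x0 [n00 prox inter nx0]]] := @proximal_normal_of_cone_bound _ _ dot dotE
  (hypo setT f) (w^-1 *: y, w^-1) x' c K K0 p_hypo.
(* Minimality is applied at (q/u, 1/u), then multiplied by u. *)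
- move=> [q u] qhypo /=; have u0 : 0 < u by case: qhypo => -[].
  move/hypo_dual_epi: qhypo => /minyw /=; rewrite -/c distE // => cu.
  rewrite -(ler_pM2l (_ : 0 < u^-1)) ?invr_gt0 // mulr1.
  have -> : u^-1 * (c * u - K * (u * `|x' - u^-1 *: q|)) = c - K * `|x' - u^-1 *: q|.
    by field; rewrite gt_eqF.
  by rewrite lerBlDr.
- rewrite /= distE ?invr_gt0 // invrK scalerA divff ?gt_eqF // scale1r /c.
  by field; rewrite gt_eqF.
- by rewrite /= (inj_eq (scalerI _)) // invr_eq0 gt_eqF.
move: KR; rewrite ltNge => /negP; apply.
rewrite -nx0; apply: ereal_inf_lbound; exists x0 => //.
by exists (w^-1 *: y, w^-1), n0.
Qed.

(** * From growth bounds to the Lipschitz constant *)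

Lemma perspective_lt1_of_cvg (R : realType) (E : normedModType R)
    (f : E -> \bar R) (y : E) :
  (v%:E * f (v^-1 *: y))%E @[v --> (0 : R)^'+] --> 0%E ->
  exists2 v, 0 < v & (perspective f (y, v) < 1)%E.
Proof.
move=> f0; near ((0 : R)^'+) => v; exists v; first by near: v; exact: nbhs_right_gt.
near: v; have : nbhs (0%E : \bar R) [set z | (z < 1)%E].
  by apply: open_nbhs_nbhs; split; [exact: open_ereal_lt_ereal|rewrite /= lte01].
by move/f0.
Unshelve. all: by end_near. Qed.

Lemma intercept_radius_ge0 (R : realType) (E : normedModType R)
    (dot : {dot E for idfun}) (f : E -> \bar R) :
  (0 <= intercept_radius dot f)%E.
Proof. by apply: le_ereal_inf_tmp => _ [x _ <-]; rewrite lee_fin. Qed.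

(* Qualified because the library's edist, the distance of a metric space,
   shadows the one of Defs. *)
Lemma edist_le (R : realType) (a b : \bar R) (r : R) :
  0 <= r -> (0 <= a)%E -> (0 <= b)%E ->
  (b <= a + r%:E)%E -> (a <= b + r%:E)%E -> (Defs.edist a b <= r%:E)%E.
Proof.
move=> r0; rewrite /Defs.edist; case: eqP => [_ *|]; first by rewrite lee_fin.
case: a b => [a| |] [b| |] //= _ _ _.
by rewrite -!EFinD !lee_fin ler_norml; lra.
Qed.

Lemma lee_addM_gt (R : realType) (a b : \bar R) (m t : R) :
  0 <= t -> (forall K, m < K -> (a <= b + (K * t)%:E)%E) -> (a <= b + (m * t)%:E)%E.
Proof.
move=> t0 aK; apply/lee_addgt0Pr => e e0.
have t1 : 0 < t + 1 by rewrite ltr_wpDl.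
(* The excess e t / (t + 1) is at most e; the added 1 covers t = 0. *)
apply: (le_trans (aK (m + e / (t + 1)) _)); first by rewrite ltrDl divr_gt0.
rewrite -addeA leeD2l // -EFinD lee_fin mulrDl lerD2l -mulrA ler_piMr ?(ltW e0) //.
by rewrite mulrC ler_pdivrMr // mul1r lerDl.
Qed.

Theorem proposition1 (R : realType) (E : normedModType R)
    (dot : {dot E for idfun}) (f : E -> \bar R) :
  finite_dim_euclidean dot ->
  (forall x : E, (0 <= f x)%E) ->
  upper_semicontinuous_on setT f ->
  strictly_upper_radial f ->
  (forall y : E, (v%:E * f (v^-1 *: y))%E @[v --> (0 : R)^'+] --> 0%E) ->
  elipschitz (intercept_radius dot f)^-1%E (radial_dual f).
Proof.
move=> fin_dim _ _ rad lim0 x x'.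
have small y := perspective_lt1_of_cvg _ _ _ _ (lim0 y).
have [->|xx'] := eqVneq x x'; first by rewrite /Defs.edist eqxx subrr normr0 mule0.
have R0 := intercept_radius_ge0 _ _ dot f.
(* At R(f) = 0 the constant is +oo, and x differs from x', so the bound is vacuous. *)
have [R_eq0|R_neq0] := eqVneq (intercept_radius dot f) 0%E.
  by rewrite R_eq0 inve0 gt0_mulye ?leey // lte_fin normr_gt0 subr_eq0.
(* The constant is 0 when R(f) = +oo. Only K strictly above m gives 1/K < R(f), hence the later
   passage to the limit. *)
have [m mE KR] : exists2 m : R, (intercept_radius dot f)^-1%E = m%:E & 0 <= m /\
    forall K, m < K -> (K^-1%:E < intercept_radius dot f)%E.
  case: (intercept_radius dot f) R0 R_neq0 => [r| |] // r0 rn0.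
    have {rn0 r0} r0 : 0 < r by rewrite -lte_fin lt_def rn0.
    exists r^-1; first by rewrite inver gt_eqF.
    split=> [|K rK]; first by rewrite invr_ge0 ltW.
    by rewrite lte_fin invf_plt ?posrE // (lt_trans _ rK) // invr_gt0.
  by exists 0; rewrite ?invey //; split => // K _; rewrite ltey.
case: KR => m0 KR.
have step (y y' : E) :
    (radial_dual f y' <= radial_dual f y + (m * `|y - y'|)%:E)%E.
  apply: lee_addM_gt => // K mK.
  by apply: (radial_dual_growth _ _ dot) => //; [exact: le_lt_trans mK|exact: KR].
rewrite mE -EFinM; apply: edist_le; rewrite ?radial_dual_ge0 ?mulr_ge0 //.
by rewrite distrC.
Qed.
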